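(* Let $\mathcal{F}$ be an $n$-periodic tame frieze ($n\ge 1$, not necessarily the minimal period) and let $\mathcal{L}=(m_{i,j})_{i,j\in\mathbb{Z}}$ be its lattice. Then $$m_{1,n}-m_{2,n-1}=m_{k+1,k+n}-m_{k+2,k+n-1}$$ for all $k\in\mathbb{Z}$.
   Context: A frieze is an array $\mathcal{F}=(m_{i,j})$ of real numbers, with $i\in\mathbb{Z}$, whose rows are the sets of positions with $j-i$ constant, such that $m_{i,i-2}=0$ and $m_{i,i-1}=1$ for all $i$, and such that $m_{i,j}m_{i+1,j+1}-m_{i,j+1}m_{i+1,j}=1$ whenever all four entries lie in the array. It is infinite if it is indexed by all $(i,j)$ with $j-i\ge -2$; it is finite if it is indexed by all $(i,j)$ with $-2\le j-i\le N-2$ for some integer $N\ge 3$ and ends with a row of ones followed by a row of zeros: $m_{i,i+N-3}=1$ and $m_{i,i+N-2}=0$ for all $i$. The quiddity row is $(a_i)_{i\in\mathbb{Z}}$ with $a_i=m_{i,i}$. The frieze is tame if every $3\times 3$ matrix $\begin{pmatrix} m_{i,j}&m_{i+1,j}&m_{i+2,j}\\ m_{i,j+1}&m_{i+1,j+1}&m_{i+2,j+1}\\ m_{i,j+2}&m_{i+1,j+2}&m_{i+2,j+2}\end{pmatrix}$ of entries of the array has determinant $0$. It is $n$-periodic if $m_{i+n,j+n}=m_{i,j}$ for all entries. The lattice $\mathcal{L}=(m_{i,j})_{i,j\in\mathbb{Z}}$ of $\mathcal{F}$ is the extension of $\mathcal{F}$ to all of $\mathbb{Z}^2$ by anti-symmetric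 mirroring across rows of zeros: if $\mathcal{F}$ is infinite, $m_{i,j}=-m_{j+2,i-2}$ for $j-i<-2$; if $\mathcal{F}$ is finite, $\mathcal{L}$ is the unique extension satisfying $m_{i,j}=-m_{j+2,i-2}$ and $m_{i,j}=-m_{j-N+2,i+N-2}$ for all $i,j\in\mathbb{Z}$. *)

(* Defs.v *)
From HB Require Import structures.
From mathcomp Require Import all_boot all_order all_algebra.
From mathcomp Require Import reals.
From mathcomp Require Import zify.

Set Implicit Arguments.
Unset Strict Implicit.
Unset Printing Implicit Defensive.

Import Order.TTheory GRing.Theory Num.Theory.
Local Open Scope ring_scope.

(* The row of position (i, j) is the value of j - i; in [Finite N] the rows
   run from -2 to N - 2. *)
Variant extent := Infinite | Finite of int.

Definition in_array (s : extent) (i j : int) : bool :=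
  match s with
  | Infinite => - 2 <= j - i
  | Finite N => - 2 <= j - i <= N - 2
  end.

(* An array of extent s is encoded as a total function m : int -> int -> R whose
   values outside [in_array s] are irrelevant: no definition below looks at
   them. *)

Definition is_frieze (R : realType) (s : extent) (m : int -> int -> R) : Prop :=
  [/\ forall i, m i (i - 2) = 0,
      forall i, m i (i - 1) = 1,
      forall i j, in_array s i j -> in_array s (i + 1) (j + 1) ->
        in_array s i (j + 1) -> in_array s (i + 1) j ->
        m i j * m (i + 1) (j + 1) - m i (j + 1) * m (i + 1) j = 1
    & match s with
      | Infinite => True
      | Finite N => [/\ 3 <= N, forall i, m i (i + N - 3) = 1
                      & forall i, m i (i + N - 2) = 0]
      end].

Definition tame (R : realType) (s : extent) (m : int -> int -> R) : Prop :=
  forall i j : int,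
    (forall p q : 'I_3, in_array s (i + (q : nat)%:Z) (j + (p : nat)%:Z)) ->
    \det (\matrix_(p < 3, q < 3) m (i + (q : nat)%:Z) (j + (p : nat)%:Z)) = 0.

Definition periodic (R : realType) (s : extent) (n : nat)
    (m : int -> int -> R) : Prop :=
  forall i j, in_array s i j -> m (i + n%:Z) (j + n%:Z) = m i j.

Definition is_lattice (R : realType) (s : extent) (m L : int -> int -> R) :
    Prop :=
  (forall i j, in_array s i j -> L i j = m i j) /\
  match s with
  | Infinite => forall i j, j - i < - 2 -> L i j = - m (j + 2) (i - 2)
  | Finite N => forall i j,
      L i j = - L (j + 2) (i - 2) /\
      L i j = - L (j - N + 2) (i + N - 2)
  end.

Fact divz_bounds (d e : int) : 0 < e ->
  0 <= d - (d %/ e)%Z * e /\ d - (d %/ e)%Z * e < e.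
Proof.
move=> e0; have := modz_ge0 d (lt0r_neq0 e0); have := ltz_pmod d e0.
by rewrite (_ : d - _ = (d %% e)%Z) // {1}(divz_eq d e) addrC addKr.
Qed.

(* A frieze has exactly one lattice, up to pointwise equality. *)
Lemma lattice_exists (R : realType) (s : extent) (m : int -> int -> R) :
  is_frieze s m -> exists L, is_lattice s m L.
Proof.
case: s => [|N] [m0 _ _ mN].
  exists (fun i j => if - 2 <= j - i then m i j else - m (j + 2) (i - 2)).
  split=> [i j /= -> //|i j ltd]; rewrite ifF //; lia.
case: mN => N3 _ mN.
pose f (i j : int) := if j - i <= N - 2 then m i j
                      else - m (j - N + 2) (i + N - 2).
pose q (i j : int) := ((j - i + 2) %/ (2 * N))%Z.
exists (fun i j => f (i + q i j * N) (j - q i j * N)).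
have key i j k : 0 <= j - i + 2 - k * (2 * N) < 2 * N -> q i j = k.
  by rewrite /q => H; nia.
split=> [i j /= ij|i j].
  rewrite (key i j 0); last lia.
  by rewrite mul0r addr0 subr0 /f ifT //; lia.
have [d0 d1] : 0 <= j - i + 2 - q i j * (2 * N) /\
  j - i + 2 - q i j * (2 * N) < 2 * N by apply: divz_bounds; lia.
set k := q i j in d0 d1 *.
have [d00|dn0] := eqVneq (j - i + 2 - k * (2 * N)) 0.
  have z x y : y = x - 2 -> f x y = 0.
    by move=> ->; rewrite /f ifT ?m0 //; lia.
  rewrite (key (j + 2) (i - 2) (- k)); last lia.
  rewrite (key (j - N + 2) (i + N - 2) (1 - k)); last lia.
  by rewrite !z ?oppr0 //; lia.
rewrite (key (j + 2) (i - 2) (- k - 1)); last lia.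
rewrite (key (j - N + 2) (i + N - 2) (- k)); last lia.
have sgn x y : f x y = - f (y - N + 2) (x + N - 2).
  rewrite /f; case: ifP => h1; case: ifP => h2 //; try lia.
  - have e : y = x + N - 2 by lia.
    rewrite [in LHS]e mN [X in - m _ X](_ : _ = y - N + 2 + N - 2) ?mN ?oppr0 //.
    by lia.
  - by rewrite opprK; congr m; lia.
by split; rewrite [LHS]sgn; congr (- f _ _); lia.
Qed.

Lemma lattice_unique (R : realType) (s : extent) (m L L' : int -> int -> R) :
  is_frieze s m -> is_lattice s m L -> is_lattice s m L' ->
  forall i j, L i j = L' i j.
Proof.
case: s => [|N] [_ _ _ mN] [Lm LS] [Lm' LS'] i j.
  by have [h|h] := leP (- 2) (j - i); [rewrite Lm ?Lm'|rewrite LS ?LS'].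
case: mN => N3 _ _.
have trans (M : int -> int -> R) : (forall i j, M i j = - M (j + 2) (i - 2) /\
    M i j = - M (j - N + 2) (i + N - 2)) ->
    forall (k : int) x y, M x y = M (x + k * N) (y - k * N).
  move=> MS.
  have t x y : M x y = M (x - N) (y + N).
    by rewrite (MS x y).1 (MS (y + 2) _).2 opprK; congr M; lia.
  have u (k : nat) x y : M x y = M (x - k%:Z * N) (y + k%:Z * N).
    elim: k => [|k IHk] in x y *; first by rewrite mul0r subr0 addr0.
    by rewrite t IHk; congr M; lia.
  case=> k x y; last by rewrite (u k.+1); congr M; lia.
  by rewrite [RHS](u k); congr M; lia.
pose k := ((j - i + 2) %/ (2 * N))%Z.
rewrite (trans L LS k) (trans L' LS' k).
set x := i + _; set y := j - _.
have [d0 d1] : - 2 <= y - x /\ y - x < 2 * N - 2.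
  by have [] := @divz_bounds (j - i + 2) (2 * N); rewrite -/k /x /y; lia.
have [h|h] := leP (y - x) (N - 2); first by rewrite Lm ?Lm' //= d0.
by rewrite (LS x y).2 (LS' x y).2 Lm ?Lm' //=; lia.
Qed.

(* Main.v *)
Require Import Defs.
From mathcomp Require Import all_boot all_order all_algebra.
From mathcomp Require Import reals.
From mathcomp Require Import zify ring.

(** Tameness forces every row of entries [j |-> m i j] to solve the linear
    recurrence [x (j + 1) = a (j + 1) * x j - x (j - 1)], where [a] is the
    quiddity row. Let [u], [v] be two solutions on all of [int] with Wronskian
    [1]. Then [F i j = u (i - 2) * v j - u j * v (i - 2)] agrees with [m] on the
    array and has the symmetries of the lattice, so it is the lattice. Expanding
    [F] and using that [a] is [n]-periodic, the difference
    [F (k + 1) (k + n) - F (k + 2) (k + n - 1)] is unchanged by [k -> k + 1]. *)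

Import Order.TTheory GRing.Theory Num.Theory.
Local Open Scope ring_scope.

Definition solves {R : realType} (a x : int -> R) : Prop :=
  forall j, x (j + 1) = a (j + 1) * x j - x (j - 1).

Lemma solution_nat_exists {R : realType} (a : nat -> R) (x0 x1 : R) :
  exists f : nat -> R, [/\ f 0 = x0, f 1 = x1 &
    forall k, f k.+2 = a k * f k.+1 - f k].
Proof.
pose g := fix g k : R * R :=
  if k is k'.+1 then ((g k').2, a k' * (g k').2 - (g k').1) else (x0, x1).
by exists (fun k => (g k).1); split.
Qed.

(** The recurrence is invariant under reversal of the index. So one sequence [f] runs forward from
    positions 0 and 1, another [g] runs backward from positions 1 and 0, and they are glued along
    this overlap. *)
Lemma solution_exists {R : realType} (a : int -> R) (x0 x1 : R) :
  exists x, [/\ solves a x, x 0 = x0 & x 1 = x1].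
Proof.
have [f [f0 f1 fS]] := solution_nat_exists (fun k => a k.+2%:Z) x0 x1.
have [g [g0 g1 gS]] := solution_nat_exists (fun k => a (1 - k%:Z)) x1 x0.
pose x (j : int) := match j with Posz k => f k | Negz k => g k.+2 end.
have xN (k : nat) : x (1 - k%:Z) = g k.
  case: k => [|[|k]]; rewrite ?g0 ?g1 -?f0 -?f1 //.
  by rewrite (_ : 1 - k.+2%:Z = Negz k) //; lia.
exists x; split=> // j.
have [[k ->]|[k ->]] : (exists k : nat, j = k.+1%:Z) \/
    (exists k : nat, j = - k%:Z).
  by case: j => [[|k]|k]; [right; exists 0|left; exists k|right; exists k.+1].
- have -> : k.+1%:Z + 1 = k.+2%:Z by lia.
  have -> : k.+1%:Z - 1 = k%:Z by lia.
  exact: fS.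
- have -> : - k%:Z - 1 = 1 - k.+2%:Z by lia.
  have -> : - k%:Z + 1 = 1 - k%:Z by lia.
  have -> : x (- k%:Z) = g k.+1 by rewrite -xN; congr x; lia.
  by rewrite !xN gS; ring.
Qed.

Lemma int_shift_invariant {T : Type} (f : int -> T) :
  (forall k, f (k + 1) = f k) -> forall k, f k = f 0.
Proof.
move=> fS; case=> k; elim: k => [|k IHk] //.
- by rewrite -IHk -[RHS]fS; congr f; lia.
- by rewrite -[LHS]fS.
- by rewrite -IHk -[LHS]fS; congr f; lia.
Qed.

Lemma wronskian {R : realType} (a u v : int -> R) :
  solves a u -> solves a v -> u 0 * v 1 - u 1 * v 0 = 1 ->
  forall j, u j * v (j + 1) - u (j + 1) * v j = 1.
Proof.
move=> su sv w1 j.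
rewrite (int_shift_invariant (fun j => u j * v (j + 1) - u (j + 1) * v j)) //.
by move=> k; rewrite (su (k + 1)) (sv (k + 1)) addrK; ring.
Qed.

(** By [e02] the vectors [(u0, v0)] and [(u2, v2)] are parallel, and their determinants with
    [(u1, v1)] are opposite. This yields the antiperiodicity of [u] and [v] for finite friezes. *)
Lemma wronskian_opp {R : realType} (u0 v0 u1 v1 u2 v2 : R) :
  u0 * v2 - u2 * v0 = 0 -> u0 * v1 - u1 * v0 = 1 -> u1 * v2 - u2 * v1 = 1 ->
  u2 = - u0 /\ v2 = - v0.
Proof.
move=> e02 e01 e12; split; apply/eqP; rewrite -addr_eq0; apply/eqP.
  by rewrite -[u2]mulr1 -[X in _ + X]mulr1 -{1}e01 -e12 -(mulr0 u1) -e02; ring.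
by rewrite -[v2]mulr1 -[X in _ + X]mulr1 -{1}e01 -e12 -(mulr0 v1) -e02; ring.
Qed.

(** Row 2 minus [a] times row 1 plus row 0 vanishes outside column 0, and the complementary minor is
    1. *)
Lemma det3_rows {R : realType} (f : nat -> nat -> R) (a : R) :
  f 2 1 = a * f 1 1 - f 0 1 -> f 2 2 = a * f 1 2 - f 0 2 ->
  f 0 1 * f 1 2 - f 1 1 * f 0 2 = 1 ->
  \det (\matrix_(p < 3, q < 3) f p q) = f 0 0 - a * f 1 0 + f 2 0.
Proof.
move=> h1 h2 w.
rewrite (expand_det_col _ 0) !big_ord_recl big_ord0 /cofactor.
rewrite !(expand_det_row _ 0) !big_ord_recl !big_ord0 /cofactor !det_mx11 !mxE.
rewrite /= /bump /= !add0n !addn0 h1 h2.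
rewrite -[RHS]mulr1 -[in RHS]w.
ring.
Qed.

(** Induction on [j - i]. The rows of zeros and ones and the unimodular rule settle [j - i <= 1].
    Beyond that, columns [p + 1] and [p + 2] of a 3 by 3 block satisfy the recurrence, and its zero
    determinant passes it on to column [p]. *)
Lemma tame_recurrence {R : realType} (s : extent) (m : int -> int -> R) :
  is_frieze s m -> tame s m -> forall i j, i <= j -> in_array s i j ->
  m i j = m j j * m i (j - 1) - m i (j - 2).
Proof.
move=> [m0 m1 mSL _] tm i j ij.
have [d ->] : exists d : nat, i = j - d%:Z by exists (absz (j - i)); lia.
have SL2 p q : p - 1 <= q -> in_array s p (q + 1) ->
    m p q * m (p + 1) (q + 1) - m p (q + 1) * m (p + 1) q = 1.
  by move=> pq h; apply: mSL; move: h; case: (s) => [|N] /=; lia.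
elim/ltn_ind: d => -[|[|d]] IHd h.
- by rewrite subr0 m0 m1; ring.
- have -> : m (j - 1%:Z) (j - 2) = 1 by rewrite -(m1 (j - 1)); congr m; lia.
  have : m (j - 1) (j - 1) * m j j - m (j - 1) j * m j (j - 1) = 1.
    by have := SL2 (j - 1) (j - 1); rewrite subrK => -> //; lia.
  by rewrite m1 => <-; ring.
have IH1 := IHd d.+1 (leqnn _); have IH2 := IHd d (leqnSn _).
move: h IH1 IH2; set p := j - d.+2%:Z => h.
have -> : j - d.+1%:Z = p + 1 by rewrite /p; lia.
have -> : j - d%:Z = p + 2 by rewrite /p; lia.
have pj : p + 2 <= j by rewrite /p; lia.
move=> IH1 IH2.
(* The extreme corners of the block are [(p, j)], in the array by [h], and [(p + 2, j - 2)], no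
   lower than row -2 by [pj]. *)
have arr q r : p <= q <= p + 2 -> j - 2 <= r <= j -> in_array s q r.
  by move: h; case: (s) => [|N] /=; lia.
have := tm p (j - 2).
have j1 : j - 2 + 1%:Z = j - 1 by lia.
have j2 : j - 2 + 2%:Z = j by lia.
rewrite (det3_rows (fun r q => m (p + q%:Z) (j - 2 + r%:Z)) (m j j)).
- rewrite !addr0 j1 j2 => det0.
  apply/eqP; rewrite -subr_eq0 -det0; first by apply/eqP; ring.
  by move=> [r r3] [q q3]; apply: arr => /=; lia.
- by rewrite addr0 j1 j2; apply: IH1; apply: arr; lia.
- by rewrite addr0 j1 j2; apply: IH2; apply: arr; lia.
have := SL2 (p + 1) (j - 2).
rewrite !addr0 j1 (_ : p + 1 + 1 = p + 2) ?(_ : j - 2 + 1 = j - 1); try lia.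
by apply; [lia|apply: arr; lia].
Qed.

Theorem theorem2p2 (R : realType) (s : extent) (m L : int -> int -> R) (n : nat)
    (hn : (1 <= n)%N) (hF : is_frieze s m) (hT : tame s m)
    (hP : periodic s n m) (hL : is_lattice s m L) (k : int) :
  L 1 n%:Z - L 2 (n%:Z - 1)
  = L (k + 1) (k + n%:Z) - L (k + 2) (k + n%:Z - 1).
Proof.
have [m0 m1 mSL mN] := hF.
pose a j := m j j.
have [u [su u0 u1]] := solution_exists a 1 0.
have [v [sv v0 v1]] := solution_exists a 0 1.
have w : forall j, u j * v (j + 1) - u (j + 1) * v j = 1.
  by apply: (wronskian a u v su sv); rewrite u0 u1 v0 v1; ring.
pose F i j := u (i - 2) * v j - u j * v (i - 2).
have F1 i : F i (i - 1) = 1.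
  by rewrite -(w (i - 2)) /F (_ : i - 1 = i - 2 + 1) //; lia.
have FR i j : F i j = a j * F i (j - 1) - F i (j - 2).
  rewrite /F -[in v j](subrK 1 j) -[in u j](subrK 1 j) su sv subrK.
  by rewrite -addrA -opprD; ring.
have Fm i j : in_array s i j -> F i j = m i j.
  have [ij|ij] := ltP j (i - 2); first by case: (s) => [|N] /=; lia.
  have [d ->] : exists d : nat, j = i + d%:Z - 2.
    by exists (absz (j - i + 2)); lia.
  elim/ltn_ind: d => -[|[|d]] IHd h.
  - by rewrite addr0 m0 /F; ring.
  - by rewrite (_ : i + 1%:Z - 2 = i - 1) ?m1 ?F1 //; lia.
  rewrite FR (tame_recurrence s m hF hT) //; last by lia.
  have -> : i + d.+2%:Z - 2 - 1 = i + d.+1%:Z - 2 by lia.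
  have -> : i + d.+2%:Z - 2 - 2 = i + d%:Z - 2 by lia.
  rewrite !IHd //; move: h; case: (s) => [|N] /=; lia.
have hFL : is_lattice s m F.
  split=> [i j /Fm //|].
  case: s mN Fm {hF hT hP hL mSL} => [_|N [N3 mN1 mN0]] Fm i j.
    by move=> ij; rewrite -Fm /= /F ?addrK; [ring|lia].
  split; first by rewrite /F addrK; ring.
  (* The closing rows of zeros and ones, read through [F], determine the solutions at [c + N] from
     those at [c]. *)
  have anti c : u (c + N) = - u c /\ v (c + N) = - v c.
    have E0 : F (c + 2) (c + N) = 0.
      by rewrite Fm /=; [rewrite -(mN0 (c + 2)); congr m|]; lia.
    have E1 : F (c + 2) (c + N - 1) = 1.
      by rewrite Fm /=; [rewrite -(mN1 (c + 2)); congr m|]; lia.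
    have := w (c + N - 1); rewrite subrK => W.
    move: E0 E1; rewrite /F addrK => E0 E1.
    exact: wronskian_opp E0 E1 W.
  rewrite /F.
  have [uj vj] := anti (j - N); have [ui vi] := anti (i - 2).
  rewrite subrK in uj vj.
  have -> : j - N + 2 - 2 = j - N by lia.
  have -> : i + N - 2 = i - 2 + N by lia.
  by rewrite ui vi uj vj; ring.
have an j : a (j + n%:Z) = a j.
  apply: hP; case: (s) mN => [|N] /=; first by lia.
  by move=> [N3 _ _]; lia.
rewrite !(lattice_unique hF hL hFL).
(* [T k] is the trace of the monodromy, the action of the shift by [n] on the solutions. *)
pose T k := F (k + 1) (k + n%:Z) - F (k + 2) (k + n%:Z - 1).
have -> : F 1 n%:Z - F 2 (n%:Z - 1) = T 0 by rewrite /T !add0r.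
rewrite -[RHS]/(T k); apply/esym/(int_shift_invariant T) => {}k.
have shift x : solves a x ->
    x (k + 1 + n%:Z) = a (k + 1) * x (k + n%:Z) - x (k + n%:Z - 1).
  by move=> sx; rewrite -an [k + 1 + _]addrAC sx.
rewrite /T /F.
have -> : k + 1 + 1 - 2 = k by lia.
have -> : k + 1 + 2 - 2 = k + 1 by lia.
have -> : k + 1 - 2 = k - 1 by lia.
have -> : k + 2 - 2 = k by lia.
have -> : k + 1 + n%:Z - 1 = k + n%:Z by lia.
(* Both expansions carry the same coefficient [a (k + 1)], whose terms cancel. *)
rewrite !shift // su sv.
ring.
Qed.
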